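(* There are exactly fifteen $\overline{\mathbb{Q}}$-conjugacy classes of cubic postcritically finite polynomials defined over $\mathbb{Q}$, represented by the following polynomials. That is, each of the following fifteen polynomials is postcritically finite, no two of them are conjugate over $\overline{\mathbb{Q}}$, and every postcritically finite polynomial $f(z)\in\mathbb{Q}[z]$ of degree $3$ is conjugate over $\overline{\mathbb{Q}}$ to one of them: (1) $z^3$; (2) $-z^3+1$; (3) $-2z^3+3z^2+\frac12$; (4) $-2z^3+3z^2$; (5) $-z^3+\frac32 z^2+1$; (6) $2z^3-3z^2+1$; (7) $2z^3-3z^2+\frac12$; (8) $z^3-\frac32 z^2$; (9) $-3z^3+\frac92 z^2$; (10) $-4z^3+6z^2-\frac12$; (11) $4z^3-6z^2+\frac32$; (12) $3z^3-\frac92 z^2+1$; (13) $-z^3+\frac32 z^2-1$; (14) $-\frac14 z^3+\frac32 z+2$; (15) $-\frac1{28}z^3-\frac34 z+\frac72$.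
   Context: For a polynomial $f$, $f^n$ denotes the $n$-th iterate ($f^0(z)=z$). The orbit of $\alpha$ is $\{f^n(\alpha): n\ge 0\}$. Critical points of $f$ are the $\alpha\in\overline{\mathbb{Q}}$ with $f'(\alpha)=0$. $f$ is postcritically finite (PCF) if the orbit of each critical point is finite. Polynomials $f,g$ are conjugate over $\overline{\mathbb{Q}}$ if $g=\phi\circ f\circ\phi^{-1}$ for some affine map $\phi(z)=\alpha z+\beta$ with $\alpha,\beta\in\overline{\mathbb{Q}}$, $\alpha\ne 0$. *)

(* Defs.v *)
(* algC, the field of algebraic complex numbers, plays the role of the
   algebraic closure of the rationals. *)
From mathcomp Require Import all_boot all_order all_algebra all_field.

Set Implicit Arguments.
Unset Strict Implicit.
Unset Printing Implicit Defensive.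

Import GRing.Theory.
Local Open Scope ring_scope.

Definition finite_orbit (f : {poly algC}) (a : algC) : Prop :=
  exists s : seq algC, forall n : nat, iter n (horner f) a \in s.

Definition critical_point (f : {poly algC}) (a : algC) : Prop :=
  root f^`() a.

Definition PCF (f : {poly algC}) : Prop :=
  forall a : algC, critical_point f a -> finite_orbit f a.

(* With phi(z) = a z + b, the inverse is phi^-1(z) = a^-1 (z - b), and
   p \Po q is the polynomial p(q(z)). *)
Definition conjugate (f g : {poly algC}) : Prop :=
  exists a b : algC, a != 0 /\
    g = (a *: 'X + b%:P) \Po (f \Po (a^-1 *: ('X - b%:P))).

Definition toQbar (f : {poly rat}) : {poly algC} := map_poly ratr f.

Definition cubicPCFlist : seq {poly rat} :=
  [:: 'X^3;
      - 'X^3 + 1;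
      - 2 *: 'X^3 + 3 *: 'X^2 + (1 / 2)%:P;
      - 2 *: 'X^3 + 3 *: 'X^2;
      - 'X^3 + (3 / 2) *: 'X^2 + 1;
      2 *: 'X^3 - 3 *: 'X^2 + 1;
      2 *: 'X^3 - 3 *: 'X^2 + (1 / 2)%:P;
      'X^3 - (3 / 2) *: 'X^2;
      - 3 *: 'X^3 + (9 / 2) *: 'X^2;
      - 4 *: 'X^3 + 6 *: 'X^2 - (1 / 2)%:P;
      4 *: 'X^3 - 6 *: 'X^2 + (3 / 2)%:P;
      3 *: 'X^3 - (9 / 2) *: 'X^2 + 1;
      - 'X^3 + (3 / 2) *: 'X^2 - 1;
      - (1 / 4) *: 'X^3 + (3 / 2) *: 'X + 2%:P;
      - (1 / 28) *: 'X^3 - (3 / 4) *: 'X + (7 / 2)%:P].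

(* Main.v *)
From Stdlib Require Import ZArith.
Require Import Defs.
From mathcomp Require Import all_boot all_order all_algebra all_field.
From mathcomp Require Import ring zify.
From mathcomp Require Import ssrZ.

Set Implicit Arguments.
Unset Strict Implicit.
Unset Printing Implicit Defensive.

Import Order.TTheory GRing.Theory Num.Theory.
Local Open Scope ring_scope.
Delimit Scope Z_scope with BinZ.

(* Every cubic is conjugate to G(z) = (z^3 - 3 m z + g) / 4, with critical
   points a and -a where a^2 = m, and the pair (m, k) with k = g^2 determines
   the conjugacy class; it is rational when the cubic is.

   If G is PCF, let X be the finite union of the orbits of a and -a.  From
   a^3 = G(-a) - G(a) and x^3 = 3 a^2 x + 4 G(x) - 2 (G(a) + G(-a)) the ring
   generated by X is a finitely generated abelian group, so X consists of
   algebraic integers, and m, k are integers.  Comparing sizes at an element of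
   X of largest absolute value M gives |m|^3 <= 4 M^2 and M^2 <= 3 |m| + 8,
   whence |m| <= 4, M^2 <= 20 and |k| <= 16 M^2 <= 320.

   For the n-th iterates x, y of a and -a, the numbers (x + y)^2, x y and
   g (x + y) are rational algebraic integers, hence integers, bounded in terms
   of M, and obey an explicit recurrence in m and k.  Integrality and bounds
   over the first four steps leave exactly fifteen pairs (m, k). *)

(** * Cubics under affine conjugation, and their invariants *)

Definition cubic (R : nzRingType) (A B C D : R) : {poly R} :=
  A *: 'X^3 + B *: 'X^2 + C *: 'X + D%:P.

(* The constant coefficient after translating the inflection point -B/(3A) to 0. *)
Definition centred_coef (F : fieldType) (A B C D : F) : F :=
  D - B * C / (3 * A) + 2 * B ^+ 3 / (27 * A ^+ 2) + B / (3 * A).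

(* For [normal_cubic m g] these invariants are m and g^2. *)
Definition crit_invariant (F : fieldType) (A B C D : F) : F :=
  4 * (B ^+ 2 - 3 * A * C) / (9 * A).

Definition const_invariant (F : fieldType) (A B C D : F) : F :=
  64 * A * centred_coef A B C D ^+ 2.

Lemma coef_cubic (R : nzRingType) (A B C D : R) :
  [/\ (cubic A B C D)`_3 = A, (cubic A B C D)`_2 = B,
      (cubic A B C D)`_1 = C & (cubic A B C D)`_0 = D].
Proof.
by rewrite /cubic; split; rewrite !coefE /= ?(mulr1, mulr0, addr0, add0r).
Qed.

Lemma cubic_inj (R : nzRingType) (A B C D A' B' C' D' : R) :
  cubic A B C D = cubic A' B' C' D' -> [/\ A = A', B = B', C = C' & D = D'].
Proof.
move=> e; have [] := coef_cubic A B C D; rewrite e.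
by have [-> -> -> ->] := coef_cubic A' B' C' D'.
Qed.

Lemma cubicE (R : nzRingType) (f : {poly R}) :
  (size f <= 4)%N -> f = cubic f`_3 f`_2 f`_1 f`_0.
Proof.
move=> sf; apply/polyP=> -[|[|[|[|i]]]];
  rewrite !coefE /= ?(mulr1, mulr0, addr0, add0r) //.
by rewrite nth_default // (leq_trans sf).
Qed.

Lemma horner_cubic (R : comNzRingType) (A B C D x : R) :
  (cubic A B C D).[x] = A * x ^+ 3 + B * x ^+ 2 + C * x + D.
Proof. by rewrite /cubic !hornerE. Qed.

Lemma size_cubic (R : nzRingType) (A B C D : R) :
  A != 0 -> size (cubic A B C D) = 4%N.
Proof.
move=> A0; apply/eqP; rewrite eqn_leq; apply/andP; split; last first.
  by apply: contraR A0; rewrite -leqNgt => /leq_sizeP/(_ 3 (leqnn _));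
     case: (coef_cubic A B C D) => -> _ _ _ ->.
apply/leq_sizeP=> -[|[|[|[|i]]]] // _.
by rewrite !coefE /= ?(mulr1, mulr0, addr0, add0r).
Qed.

Lemma affine_conj_cubic (F : fieldType) (A B C D a b : F) : a != 0 ->
  (a *: 'X + b%:P) \Po (cubic A B C D \Po (a^-1 *: ('X - b%:P))) =
  cubic (A / a ^+ 2) (B / a - 3 * A * b / a ^+ 2)
        (C - 2 * B * b / a + 3 * A * b ^+ 2 / a ^+ 2)
        (a * D + b - C * b + B * b ^+ 2 / a - A * b ^+ 3 / a ^+ 2).
Proof.
move=> a0; rewrite /cubic !(comp_polyD, comp_polyZ, comp_polyC, comp_polyX).
rewrite !(comp_Xn_poly) -!mul_polyC -exprVn.
have: a * a^-1 = 1 by rewrite divff.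
move: (a^-1) => i /(congr1 (@polyC F)); rewrite polyCM => ai.
rewrite !(polyCD, polyCB, polyCM, polyC_exp, polyCN).
move: ai; set pa := a%:P; set pi := i%:P => ai.
set pA := A%:P; set pB := B%:P; set pC := C%:P; set pb := b%:P.
rewrite !polyC1.
have e : pa * pi - 1 = 0 by rewrite ai polyC1 subrr.
pose Y := 'X - pb.
apply/eqP; rewrite -subr_eq0; apply/eqP.
(* Expanded in powers of [Y], the two sides differ by a factor [pa * pi] on each nonconstant term,
   so their difference is [pa * pi - 1] times this cofactor. *)
rewrite -[RHS](mul0r (pA * pi ^+ 2 * Y ^+ 3 + pB * pi * Y ^+ 2 + pC * Y)) -e.
rewrite /Y; ring.
Qed.

Lemma conjugate_cubicE A B C D g :
  conjugate (cubic A B C D) g <-> exists a b : algC, a != 0 /\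
   g = cubic (A / a ^+ 2) (B / a - 3 * A * b / a ^+ 2)
        (C - 2 * B * b / a + 3 * A * b ^+ 2 / a ^+ 2)
        (a * D + b - C * b + B * b ^+ 2 / a - A * b ^+ 3 / a ^+ 2).
Proof.
by split=> -[a] [b] [a0 ->]; exists a, b; rewrite affine_conj_cubic.
Qed.

Lemma conjugate_invariants A B C D A' B' C' D' : A != 0 ->
  conjugate (cubic A B C D) (cubic A' B' C' D') ->
  crit_invariant A B C D = crit_invariant A' B' C' D' /\
  const_invariant A B C D = const_invariant A' B' C' D'.
Proof.
move=> A0 /conjugate_cubicE [a [b [a0 e]]].
have [-> -> -> ->] := cubic_inj e.
rewrite /crit_invariant /const_invariant /centred_coef.
by split; field; rewrite A0 a0.
Qed.

(* (z^3 - 3 m z + g) / 4: the critical points are the square roots of m, and the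
   factor 1/4 is what makes the postcritical orbits algebraic integers. *)
Definition normal_cubic (m g : algC) : {poly algC} :=
  cubic (1 / 4) 0 (- (3 / 4) * m) (g / 4).

(** A scaling [a] with [a ^+ 2 = 4 * A] makes the leading coefficient [1 / 4], and the shift
    [a * B / (3 * A)] moves the inflection point to 0. The sign of [a] is a free choice, hence only
    [g ^+ 2] is expressed in the coefficients. *)
Lemma conjugate_normal_cubic A B C D : A != 0 ->
  exists2 g, g ^+ 2 = const_invariant A B C D &
    conjugate (cubic A B C D) (normal_cubic (crit_invariant A B C D) g).
Proof.
move=> A0; have [a a2] : exists a, a ^+ 2 = 4 * A.
  by exists (sqrtC (4 * A)); exact: sqrtCK.
have a0 : a != 0 by rewrite -sqrf_eq0 a2 mulf_neq0 // pnatr_eq0.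
exists (4 * a * centred_coef A B C D).
  by rewrite !exprMn a2 /const_invariant; ring.
apply/conjugate_cubicE; exists a, (a * B / (3 * A)); split=> //.
have -> : (a * B / (3 * A)) ^+ 3 = a * (4 * A) * (B / (3 * A)) ^+ 3.
  by rewrite -a2; field; rewrite A0.
have -> : (a * B / (3 * A)) ^+ 2 = (4 * A) * (B / (3 * A)) ^+ 2.
  by rewrite -a2; field; rewrite A0.
rewrite /normal_cubic a2 /crit_invariant /centred_coef.
congr cubic; try by field; rewrite ?A0 ?a0.
- have -> : B / a = B * a / (4 * A) by rewrite -a2; field; rewrite a0.
  by field; rewrite A0.
- have -> : B * ((4 * A) * (B / (3 * A)) ^+ 2) / a = B * (B / (3 * A)) ^+ 2 * a.
    by rewrite -a2; field; rewrite A0 a0.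
  by field; rewrite A0.
Qed.

(** * Algebraic integrality from cubic relations *)

Lemma Cint_span_mul (S S' : seq algC) (x : algC) :
    (forall y, y \in S -> x * y \in Cint_span S') ->
  forall v, v \in Cint_span S -> x * v \in Cint_span S'.
Proof.
move=> xS v /(Cint_spanP (in_tuple S)) [a ->].
rewrite mulr_sumr rpred_sum // => i _.
by rewrite -mulrzr mulrA mulrzr rpredMz // xS // mem_nth.
Qed.

(** Pigeonhole principle; with [k = 2] it finds a cube in every product of more than [2 * size X]
    factors. *)
Lemma size_le_count_le (T : eqType) (X s : seq T) k :
    {subset s <= X} -> {in X, forall x, (count_mem x s <= k)%N} ->
  (size s <= k * size X)%N.
Proof.
move=> sX cs; rewrite -(perm_size (perm_count_undup s)) size_flatten.
rewrite /shape -map_comp sumnE big_map (eq_bigr (fun x => count_mem x s)); last first.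
  by move=> x _; rewrite /= size_nseq.
have [ub ub_s] : {subset undup s <= X} /\ uniq (undup s).
  by split=> [x|]; rewrite ?undup_uniq // mem_undup; apply: sX.
apply: (@leq_trans (\sum_(x <- undup s) k)).
  by rewrite !big_seq leq_sum // => x /ub; apply: cs.
by rewrite big_const_seq count_predT iter_addn_0 leq_mul2l uniq_leq_size ?orbT.
Qed.

Lemma perm_cube (T : eqType) (s : seq T) x : (3 <= count_mem x s)%N ->
  exists s', perm_eq s [:: x, x, x & s'].
Proof.
have rem1 (r : seq T) n : (n < count_mem x r)%N ->
    perm_eq r (x :: rem x r) /\ (n <= count_mem x (rem x r))%N.
  move=> c; have /perm_to_rem p : x \in r.
    by rewrite -has_pred1 has_count (leq_ltn_trans _ c).
  by split=> //; move: c; rewrite (permP p) /= eqxx.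
move=> /rem1[p1 /rem1[p2 /rem1[p3 _]]]; exists (rem x (rem x (rem x s))).
apply: perm_trans p1 _; rewrite perm_cons.
by apply: perm_trans p2 _; rewrite perm_cons.
Qed.

Fixpoint monomials (X : seq algC) (d : nat) : seq algC :=
  if d is d'.+1 then
    monomials X d' ++ [seq x * y | x <- X, y <- monomials X d']
  else [:: 1].

Lemma mem_monomials X d s : {subset s <= X} -> (size s <= d)%N ->
  \prod_(x <- s) x \in monomials X d.
Proof.
elim: d s => [|d IHd] s sX; first by case: s sX => // _ _; rewrite big_nil inE.
case: s sX => [|x s] sX /= sd; rewrite mem_cat.
  by rewrite IHd.
have [xX sX'] : x \in X /\ {subset s <= X}.
  by split=> [|y ys]; apply: sX; rewrite inE ?eqxx ?ys ?orbT.
apply/orP; right; rewrite big_cons; apply/allpairsP.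
by exists (x, \prod_(y <- s) y); split; rewrite // IHd.
Qed.

Lemma monomialsP X d y : y \in monomials X d ->
  exists s, [/\ {subset s <= X}, (size s <= d)%N & y = \prod_(x <- s) x].
Proof.
elim: d y => [|d IHd] y /=; first by rewrite inE => /eqP->; exists [::]; rewrite big_nil.
rewrite mem_cat => /orP[/IHd [s [sX sd ->]]|]; first by exists s; rewrite (leqW sd).
case/allpairsP=> -[x z] /= [xX /IHd [s [sX sd ->]] ->].
exists (x :: s); rewrite big_cons; split=> // u.
by rewrite inE => /orP[/eqP->|/sX].
Qed.

(* Repeatedly replacing a cube [x ^+ 3] by [c * a ^+ 2 * x] plus terms of lower
   degree trades factors [x != a] for factors [a], and [a ^+ 3] itself lowers
   the degree, so monomials of degree at most twice the number of generators
   span the ring they generate. *)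
Lemma cubic_relations_Aint (X : seq algC) (a : algC) (c : int) :
    a \in X -> a ^+ 3 \in Cint_span X ->
    {in X, forall x, x ^+ 3 - c%:~R * a ^+ 2 * x \in Cint_span X} ->
  {subset X <= Aint}.
Proof.
move=> aX a3 x3; pose D := (2 * size X)%N; pose V := Cint_span (monomials X D).
have consE (x : algC) s : x * \prod_(y <- s) y = \prod_(y <- x :: s) y.
  by rewrite big_cons.
have VD s : {subset s <= X} -> (size s <= D)%N -> \prod_(x <- s) x \in V.
  by move=> sX sD; apply/mem_Cint_span/mem_monomials.
have linV (v : algC) s : v \in Cint_span X -> {subset s <= X} ->
    ((size s).+1 <= D)%N -> v * \prod_(x <- s) x \in V.
  move=> vX sX sD; rewrite mulrC; apply: Cint_span_mul vX => y yX.
  rewrite mulrC consE; apply: VD => // z.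
  by rewrite inE => /orP[/eqP->|/sX].
have cube s : {subset s <= X} -> size s = D.+1 -> exists x s',
    [/\ x \in X, {subset s' <= X}, (size s').+3 = D.+1 & perm_eq s [:: x, x, x & s']].
  move=> sX sD; have /hasP[x xX /perm_cube[s' ps]] :
    has (fun x => 3 <= count_mem x s)%N X.
    apply: contraLR (leqnn (size s)) => /hasPn nc; rewrite -ltnNge {2}sD ltnS.
    by apply: size_le_count_le => // x /nc; rewrite -ltnNge ltnS.
  exists x, s'; split=> //; last by rewrite -sD (perm_size ps).
  by move=> y ys; apply: sX; rewrite (perm_mem ps) !inE ys !orbT.
(* Induction on the number of factors other than [a]: replacing [x ^+ 3] by [c * a ^+ 2 * x] lowers
   it by two at equal degree, and the remaining terms have degree at most [D]. *)
have VD1 n s : (count (predC1 a) s <= n)%N -> {subset s <= X} ->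
    (size s <= D.+1)%N -> \prod_(x <- s) x \in V.
  elim/ltn_ind: n s => n IHn s cn sX; rewrite leq_eqVlt ltnS.
  case/orP=> [/eqP sD|]; last exact: VD.
  have [x [s' [xX sX' [sD'] ps]]] := cube s sX sD.
  rewrite (perm_big _ ps) /= !big_cons.
  have [xa|xa] := eqVneq x a.
    by rewrite !mulrA -expr2 -exprSr xa; apply: linV; rewrite // -sD'.
  have -> : x * (x * (x * \prod_(j <- s') j)) =
     (x ^+ 3 - c%:~R * a ^+ 2 * x) * \prod_(j <- s') j
       + (\prod_(j <- [:: a, a, x & s']) j) *~ c.
    by rewrite !big_cons -mulrzl; ring.
  rewrite rpredD ?rpredMz //; first by apply: linV; rewrite -?sD' //; apply: x3.
  move: cn; rewrite (permP ps) /= xa => cn.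
  apply: (IHn (count (predC1 a) [:: a, a, x & s'])) => //=.
  + by rewrite eqxx xa; apply: leq_trans cn; rewrite !add0n !add1n ltnS leqnSn.
  + by move=> y; rewrite !inE => /or4P[/eqP->|/eqP->|/eqP->|/sX'].
  + by rewrite sD'.
have Vall s v : {subset s <= X} -> v \in V -> \prod_(x <- s) x * v \in V.
  elim: s v => [|x s IHs] v sX vV; first by rewrite big_nil mul1r.
  have xX : x \in X by apply: sX; rewrite mem_head.
  rewrite big_cons -mulrA; apply: (@Cint_span_mul (monomials X D)); last first.
    by apply: IHs => // y ys; apply: sX; rewrite inE ys orbT.
  move=> y /monomialsP [r [rX rD ->]].
  rewrite consE.
  apply: (VD1 _ _ (leqnn _)) => // z.
  by rewrite inE => /orP[/eqP->|/rX].
have V1 : 1 \in V by have := VD [::]; rewrite big_nil; apply.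
have mulV : mulr_closed V.
  split=> // u v uV vV; rewrite mulrC; apply: Cint_span_mul uV => y.
  by move=> /monomialsP [r [rX rD ->]]; rewrite mulrC; apply: Vall.
(* [V] is a ring that is finitely generated as an abelian group, so its elements are algebraic
   integers. *)
move=> x xX; apply: (fin_Csubring_Aint mulV (Cint_spanP (in_tuple _))).
have := Vall [:: x] 1; rewrite big_seq1 mulr1; apply=> // y.
by rewrite inE => /eqP->.
Qed.

(** * Finite orbits, critical points and the escape bound *)

Lemma finite_orbit_looping (f : {poly algC}) a : finite_orbit f a ->
  exists n, looping (horner f) a n.
Proof.
case=> s fs; exists (size s); apply: contraT => nl.
have := nl; rewrite -looping_uniq => u; have := @uniq_leq_size _ _ s u.
rewrite size_traject ltnn; apply=> x /trajectP[i _ ->]; exact: fs.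
Qed.

Lemma horner_normal_cubic m g x :
  (normal_cubic m g).[x] = (x ^+ 3 - 3 * m * x + g) / 4.
Proof. by rewrite horner_cubic; field. Qed.

Lemma critical_point_normal_cubic m g a :
  a ^+ 2 = m -> critical_point (normal_cubic m g) a.
Proof.
move=> a2; rewrite /critical_point /root /normal_cubic /cubic.
rewrite !(derivD, derivZ, derivC, derivXn, derivX) !hornerE /= -a2.
by apply/eqP; rewrite !hornerE /=; field.
Qed.

Lemma max_norm_seq (X : seq algC) a : a \in X ->
  exists2 x0, x0 \in X & {in X, forall x, `|x| <= `|x0|}.
Proof.
elim: X a => // x [|y X] IHX a aX.
  by exists x; rewrite ?mem_head // => z; rewrite inE => /eqP->.
have [x0 x0X x0_max] := IHX y (mem_head _ _).
(* [algC] is only partially ordered, but norms are real and hence comparable. *)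
case/orP: (real_leVge (normr_real x) (normr_real x0)) => le.
  by exists x0; [rewrite inE x0X orbT | move=> z; rewrite inE => /orP[/eqP->|/x0_max]].
exists x; rewrite ?mem_head // => z; rewrite inE => /orP[/eqP->//|/x0_max].
by move=> /le_trans; apply.
Qed.

(** Dividing the first bound by [M] gives [M ^+ 2 <= 3 * r + 8]; then [r ^ 3 <= 12 * r + 32], which
    fails from [r = 5] on. *)
Lemma escape_bound (r : nat) (M : algC) : 0 <= M ->
    M ^+ 3 <= 3 * r%:R * M + 8 * M -> r%:R ^+ 3 <= 4 * M ^+ 2 ->
  (r <= 4)%N /\ M ^+ 2 <= 20.
Proof.
move=> M0 M3 r3; have M2 : M ^+ 2 <= (3 * r + 8)%:R.
  move: M0; rewrite le_eqVlt => /orP[/eqP<-|M0].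
    by rewrite expr0n /= ler0n.
  by rewrite -(ler_pM2r M0) -exprSr natrD natrM mulrDl.
have r4 : (r <= 4)%N.
  have : r%:R ^+ 3 <= (4 * (3 * r + 8))%:R :> algC.
    by rewrite natrM (le_trans r3) // ler_wpM2l // ler0n.
  by rewrite -natrX ler_nat; nia.
by split=> //; apply: le_trans M2 _; rewrite ler_nat; lia.
Qed.

(** * The finite search, run on binary integers that [ZtoC] embeds in [algC] *)

Definition ZtoC (z : Z) : algC := (int_of_Z z)%:~R.

Lemma ZtoCD x y : ZtoC (x + y)%BinZ = ZtoC x + ZtoC y.
Proof. by rewrite -intrD -rmorphD. Qed.
Lemma ZtoCM x y : ZtoC (x * y)%BinZ = ZtoC x * ZtoC y.
Proof. by rewrite -intrM -rmorphM. Qed.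
Lemma ZtoCN x : ZtoC (- x)%BinZ = - ZtoC x.
Proof. by rewrite -mulrNz -rmorphN. Qed.
Lemma ZtoCB x y : ZtoC (x - y)%BinZ = ZtoC x - ZtoC y.
Proof. by rewrite -ZtoCN -ZtoCD. Qed.
Lemma ZtoC_pos p : ZtoC (Zpos p) = (Pos.to_nat p)%:R.
Proof. by []. Qed.

Lemma ZtoC_inj : injective ZtoC.
Proof. by move=> x y /intr_inj/(can_inj int_of_ZK). Qed.

Lemma ZtoC_norm_le x (n : nat) :
  `|ZtoC x| <= n%:R -> (Z.abs x <= Z.of_nat n)%BinZ.
Proof. by rewrite /ZtoC -intr_norm pmulrn ler_int; lia. Qed.

Lemma ZtoC_ex z : z \in Crat -> z \in Aint -> exists x, z = ZtoC x.
Proof.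
move=> zQ zA; have /intrP[n ->] := Cint_rat_Aint zQ zA.
by exists (Z_of_int n); rewrite /ZtoC Z_of_intK.
Qed.

Lemma ZtoC_lit : ((ZtoC 2 = 2) * (ZtoC 3 = 3) * (ZtoC 4 = 4) * (ZtoC 9 = 9)
  * (ZtoC 16 = 16))%type.
Proof. by []. Qed.

(* With x' = G(x), y' = G(y) and U = (x + y)^2, P = x y, T = g (x + y),
   [next_U], [next_P] and [next_T] are 16 U', 16 P' and 4 T'. *)
Definition next_W (m U P : Z) : Z := (U - 3 * P - 3 * m)%BinZ.
Definition next_U (m k U P T : Z) : Z :=
  (U * next_W m U P * next_W m U P + 4 * T * next_W m U P + 4 * k)%BinZ.
Definition next_P (m k U P T : Z) : Z :=
  (P * P * P - 3 * m * P * (U - 2 * P) + 9 * m * m * P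
   + T * next_W m U P + k)%BinZ.
Definition next_T (m k U P T : Z) : Z := (T * next_W m U P + 2 * k)%BinZ.

(** The bounds follow from [|x|^2, |y|^2 <= 20]; the last one concerns [(x - y)^2 = U - 4 * P]. *)
Definition in_box (U P : Z) : bool :=
  [&& Z.leb (Z.abs P) 20, Z.leb (Z.abs U) 80 & Z.leb (Z.abs (U - 4 * P)) 80].

(** Necessary conditions along [n] steps of a PCF orbit: the congruences say that the next [U], [P],
    [T] are again integers. *)
Fixpoint survives (n : nat) (m k U P T : Z) : bool :=
  in_box U P &&
  (if n is n'.+1 then
     [&& Z.eqb (next_U m k U P T mod 16) 0, Z.eqb (next_P m k U P T mod 16) 0,
         Z.eqb (next_T m k U P T mod 4) 0 &
         survives n' m k (next_U m k U P T / 16) (next_P m k U P T / 16)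
                  (next_T m k U P T / 4)]
   else true).

(* The pairs (m, k) of the fifteen polynomials, in the order of [cubicPCFlist]. *)
Definition PCF_invariants : seq (Z * Z) :=
  [:: (0, 0); (0, -64); (-2, -32); (-2, 0); (-1, -36); (2, 0); (2, 32);
      (1, 36); (-3, -12); (-4, 0); (4, 0); (3, 12); (-1, -100); (-2, -64);
      (1, -28)]%BinZ.

Definition Zrange (a : Z) (n : nat) : seq Z :=
  [seq (a + Z.of_nat i)%BinZ | i <- iota 0 n].

Lemma mem_Zrange b n a : Z.le b a -> Z.lt a (b + Z.of_nat n) -> a \in Zrange b n.
Proof.
move=> ba an; apply/mapP.
by exists (Z.to_nat (a - b)); rewrite ?mem_iota; lia.
Qed.

(** Exhaustive run over [|m| <= 4], [|k| <= 320]. The starting values [0], [- m], [0] belong to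
    [x = a], [y = - a] with [a^2 = m]. *)
Lemma survives_check :
  all (fun m => all (fun k =>
    survives 4 m k 0 (- m) 0 ==> ((m, k) \in PCF_invariants)) (Zrange (- 320) 641))
  (Zrange (- 4) 9).
Proof. by vm_compute. Qed.

Lemma survives_invariants m k :
    Z.le (Z.abs m) 4 -> Z.le (Z.abs k) 320 ->
  survives 4 m k 0 (- m) 0 -> (m, k) \in PCF_invariants.
Proof.
move=> m4 k320; have mR : m \in Zrange (- 4) 9 by apply: mem_Zrange; lia.
have kR : k \in Zrange (- 320) 641 by apply: mem_Zrange; lia.
by apply/implyP/(allP (allP survives_check m mR) k kR).
Qed.

(** * Bounded integral orbits pass the search tests *)

Lemma norm_sqr_add_le (u v : algC) :
  `|u| ^+ 2 <= 20 -> `|v| ^+ 2 <= 20 -> `|(u + v) ^+ 2| <= 80%:R.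
Proof.
move=> u20 v20; rewrite normrX.
apply: (@le_trans _ _ (`|u| ^+ 2 *+ 2 + `|v| ^+ 2 *+ 2)); last first.
  have -> : 80%:R = 20 *+ 2 + 20 *+ 2 :> algC by ring.
  by rewrite lerD ?lerMn2r.
apply: (@le_trans _ _ ((`|u| + `|v|) ^+ 2)).
  by rewrite lerXn2r ?nnegrE ?addr_ge0 ?ler_normD.
rewrite -subr_ge0; have -> : `|u| ^+ 2 *+ 2 + `|v| ^+ 2 *+ 2 - (`|u| + `|v|) ^+ 2 =
  (`|u| - `|v|) ^+ 2 by ring.
by rewrite -realEsqr rpredB ?normr_real.
Qed.

Lemma in_box_sum_prod (u v : algC) U P : `|u| ^+ 2 <= 20 -> `|v| ^+ 2 <= 20 ->
  (u + v) ^+ 2 = ZtoC U -> u * v = ZtoC P -> in_box U P.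
Proof.
move=> u20 v20 eU eP; apply/and3P; split; apply/Z.leb_spec0.
- apply: (@ZtoC_norm_le _ 20); rewrite -eP normrM.
  (* AM-GM: [|u| * |v|] is at most half of [|u|^2 + |v|^2]. *)
  have := lerD u20 v20; rewrite -(ler_pM2r (_ : 0 < 2^-1)) ?invr_gt0 ?ltr0n //.
  have -> : (20 + 20) * 2^-1 = 20%:R :> algC by field.
  apply: le_trans; rewrite -subr_ge0.
  have -> : (`|u| ^+ 2 + `|v| ^+ 2) / 2 - `|u| * `|v| =
    (`|u| - `|v|) ^+ 2 / 2 by field.
  by rewrite mulr_ge0 ?invr_ge0 ?ler0n // -realEsqr rpredB ?normr_real.
- by apply: (@ZtoC_norm_le _ 80); rewrite -eU norm_sqr_add_le.
- apply: (@ZtoC_norm_le _ 80); rewrite ZtoCB ZtoCM -eU -eP.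
  have -> : (u + v) ^+ 2 - ZtoC 4 * (u * v) = (u - v) ^+ 2.
    by rewrite ZtoC_lit; ring.
  by rewrite norm_sqr_add_le ?normrN.
Qed.

(** As a quotient of integers [z] is rational, and a rational algebraic integer is an integer, so
    [d] divides [a]. *)
Lemma ZtoC_div (z : algC) (a : Z) (d : positive) :
    z \in Aint -> ZtoC (Zpos d) * z = ZtoC a ->
  Z.eqb (a mod Zpos d) 0 /\ z = ZtoC (a / Zpos d).
Proof.
move=> zA; rewrite ZtoC_pos => e;
have d0 : (Pos.to_nat d)%:R != 0 :> algC by rewrite pnatr_eq0; lia.
have ez : z = ZtoC a / (Pos.to_nat d)%:R by rewrite -e mulrAC divff ?mul1r.
have [|b eb] := ZtoC_ex _ zA.
  by rewrite ez rpred_div ?rpred_nat //; apply: rpred_int.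
move: e; rewrite eb -ZtoC_pos -ZtoCM => /ZtoC_inj <-.
by rewrite Z.mul_comm Z_mod_mult Z_div_mult.
Qed.

(** [ZtoC_div] turns integrality of the next [U], [P], [T] into the tested congruences. The index
    [i] is free so that the induction can advance along the orbits. *)
Lemma survives_orbit (m k : Z) (g : algC) (x y : nat -> algC) :
    g ^+ 2 = ZtoC k ->
    (forall n, x n.+1 = (x n ^+ 3 - 3 * ZtoC m * x n + g) / 4) ->
    (forall n, y n.+1 = (y n ^+ 3 - 3 * ZtoC m * y n + g) / 4) ->
    g \in Aint -> (forall n, x n \in Aint) -> (forall n, y n \in Aint) ->
    (forall n, `|x n| ^+ 2 <= 20) -> (forall n, `|y n| ^+ 2 <= 20) ->
  forall n i U P T,
    (x i + y i) ^+ 2 = ZtoC U -> x i * y i = ZtoC P ->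
    g * (x i + y i) = ZtoC T ->
  survives n m k U P T.
Proof.
move=> g2 xS yS gA xA yA x_le y_le.
elim=> [|n IHn] i U P T eU eP eT /=;
  rewrite (in_box_sum_prod (x_le i) (y_le i) eU eP) //=.
(* [W] is the cofactor in [x^3 + y^3 - 3 m (x + y) = (x + y) W], so
   [4 (x' + y') = (x + y) W + 2 g]. *)
have W_E : ZtoC (next_W m U P) =
    (x i + y i) ^+ 2 - 3 * (x i * y i) - 3 * ZtoC m.
  by rewrite !(ZtoCD, ZtoCM, ZtoCN) -eU -eP !ZtoC_lit.
have [] := @ZtoC_div ((x i.+1 + y i.+1) ^+ 2) (next_U m k U P T) 16.
- by rewrite rpredX ?rpredD.
- rewrite /next_U; move: (next_W m U P) W_E => W W_E.
  rewrite !(ZtoCD, ZtoCM, ZtoCN) W_E -eU -eT -g2 xS yS !ZtoC_lit.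
  by field.
move=> -> eU'; have [] := @ZtoC_div (x i.+1 * y i.+1) (next_P m k U P T) 16.
- by rewrite rpredM.
- rewrite /next_P; move: (next_W m U P) W_E => W W_E.
  rewrite !(ZtoCD, ZtoCM, ZtoCN) W_E -eU -eP -eT -g2 xS yS !ZtoC_lit.
  by field.
move=> -> eP'; have [] := @ZtoC_div (g * (x i.+1 + y i.+1)) (next_T m k U P T) 4.
- by rewrite rpredM ?rpredD.
- rewrite /next_T; move: (next_W m U P) W_E => W W_E.
  rewrite !(ZtoCD, ZtoCM, ZtoCN) W_E -eT -g2 xS yS !ZtoC_lit.
  by field.
by move=> -> eT'; apply: IHn eU' eP' eT'.
Qed.

(** * The postcritical set of a normal cubic and its invariants *)

Lemma PCF_normal_cubic_orbits m g a : a ^+ 2 = m -> PCF (normal_cubic m g) ->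
  exists X : seq algC,
    [/\ forall n, iter n (horner (normal_cubic m g)) a \in X,
        forall n, iter n (horner (normal_cubic m g)) (- a) \in X &
        {in X, forall x, (normal_cubic m g).[x] \in X}].
Proof.
move=> a2 pcf; set f := normal_cubic m g.
have [n1 /loopingP l1] := finite_orbit_looping (pcf a (critical_point_normal_cubic g a2)).
have a2' : (- a) ^+ 2 = m by rewrite sqrrN.
have [n2 /loopingP l2] :=
  finite_orbit_looping (pcf _ (critical_point_normal_cubic g a2')).
exists (traject (horner f) a n1 ++ traject (horner f) (- a) n2); split=> [n|n|x].
- by rewrite mem_cat l1.
- by rewrite mem_cat l2 orbT.
- rewrite !mem_cat => /orP[] /trajectP[i _ ->]; rewrite -iterS.
    by rewrite l1.
  by rewrite l2 orbT.
Qed.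

Lemma PCF_normal_cubic_invariants m g : m \in Crat -> g ^+ 2 \in Crat ->
    PCF (normal_cubic m g) ->
  exists2 mk, mk \in PCF_invariants & m = ZtoC mk.1 /\ g ^+ 2 = ZtoC mk.2.
Proof.
move=> mQ g2Q pcf; pose a := sqrtC m; have a2 : a ^+ 2 = m by apply: sqrtCK.
clearbody a; set f := normal_cubic m g in pcf.
have [X [aX bX fX]] := PCF_normal_cubic_orbits a2 pcf.
have fE x : f.[x] = (x ^+ 3 - 3 * m * x + g) / 4 by apply: horner_normal_cubic.
(* The critical values are [(g - 2 * a ^+ 3) / 4] and [(g + 2 * a ^+ 3) / 4]; their sum and
   difference recover [g] and [a ^+ 3]. *)
have gE : g = 2 * (f.[a] + f.[- a]) by rewrite !fE; field.
have a3 : a ^+ 3 = f.[- a] - f.[a] by rewrite !fE -a2; field.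
have faX : f.[a] \in X by apply: (aX 1).
have fbX : f.[- a] \in X by apply: (bX 1).
have XA : {subset X <= Aint}.
  apply: (@cubic_relations_Aint X a 3); first exact: (aX 0).
    by rewrite a3 rpredB ?mem_Cint_span.
  move=> x xX.
  have -> : x ^+ 3 - 3%:~R * a ^+ 2 * x = f.[x] *+ 4 - (f.[a] + f.[- a]) *+ 2.
    by rewrite !fE -a2; field.
  by rewrite rpredB ?rpredMn ?rpredD ?mem_Cint_span // fX.
have gA : g \in Aint by rewrite gE mulr_natl rpredMn // rpredD // XA.
have mA : m \in Aint by rewrite -a2 rpredX ?XA //; apply: (aX 0).
have [k kE] := ZtoC_ex g2Q (rpredX 2 gA).
have [mz mE] := ZtoC_ex mQ mA.
have [x0 x0X x0_max] := max_norm_seq faX; pose M := `|x0|.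
pose r := Z.to_nat (Z.abs mz).
have rE : `|m| = r%:R.
  by rewrite mE /ZtoC -intr_norm pmulrn /r; congr (_%:~R); lia.
have M0 : 0 <= M by apply: normr_ge0.
have g_le : `|g| <= 4 * M.
  rewrite gE normrM normr_nat (_ : 4 * M = 2 * (M + M)); last by ring.
  by rewrite ler_pM2l ?ltr0n // (le_trans (ler_normD _ _)) // lerD ?x0_max.
have a3_le : `|a| ^+ 3 <= 2 * M.
  rewrite -normrX a3 (le_trans (ler_normB _ _)) // mulr_natl mulr2n.
  by rewrite lerD ?x0_max.
have [r4 M20] : (r <= 4)%N /\ M ^+ 2 <= 20.
  (* Squaring [|a|^3 <= 2 * M] bounds [|m|^3]; the bound on [M ^+ 3] comes from the equation for
     [f.[x0]], as [f.[x0]] stays in [X]. *)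
  apply: escape_bound => //; last first.
    rewrite -rE -a2 normrX exprAC (_ : 4 * M ^+ 2 = (2 * M) ^+ 2); last by ring.
    by rewrite lerXn2r ?nnegrE ?exprn_ge0 ?mulr_ge0.
  rewrite -normrX -rE.
  have -> : x0 ^+ 3 = 3 * m * x0 + (4 * f.[x0] - g) by rewrite fE; field.
  have -> : 3 * `|m| * M + 8 * M = `|3 * m * x0| + (4 * M + 4 * M).
    by rewrite !normrM normr_nat -/M; ring.
  rewrite (le_trans (ler_normD _ _)) // lerD2l (le_trans (ler_normB _ _)) //.
  by rewrite lerD // normrM normr_nat ler_pM2l ?ltr0n // x0_max ?fX.
have sq_le x : x \in X -> `|x| ^+ 2 <= 20.
  move=> xX; apply: le_trans M20; rewrite lerXn2r ?nnegrE //; exact: x0_max.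
exists (mz, k) => //; apply: survives_invariants.
- by move: r4; rewrite /r; lia.
- apply: (@ZtoC_norm_le _ 320); rewrite -kE normrX.
  apply: (@le_trans _ _ ((4 * M) ^+ 2)); first by rewrite lerXn2r ?nnegrE ?mulr_ge0.
  rewrite exprMn (_ : 320%:R = 4 ^+ 2 * 20); last by ring.
  by rewrite ler_pM2l // exprn_gt0 ?ltr0n.
apply: (@survives_orbit mz k g (fun n => iter n (horner f) a)
  (fun n => iter n (horner f) (- a)) kE _ _ gA _ _ _ _ 4 0).
1,2: by move=> n; rewrite iterS fE mE.
1,2: by move=> n; rewrite XA.
1,2: by move=> n; rewrite sq_le.
- by rewrite /= subrr expr0n.
- by rewrite /= mulrN -expr2 a2 ZtoCN mE.
- by rewrite /= subrr mulr0.
Qed.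

(** * Symmetry and transitivity of conjugacy, and invariance of PCF *)

Lemma conjugateP f g : conjugate f g <-> exists a b : algC, a != 0 /\
  g \Po (a *: 'X + b%:P) = (a *: 'X + b%:P) \Po f.
Proof.
split=> -[a [b [a0 e]]]; exists a, b; split=> //.
  rewrite e -!comp_polyA; congr (_ \Po _); rewrite -[RHS]comp_polyXr.
  congr (_ \Po _).
  rewrite comp_polyZ comp_polyB comp_polyX comp_polyC addrK scalerA mulVf //.
  by rewrite scale1r.
rewrite comp_polyA -e -comp_polyA -[LHS]comp_polyXr; congr (_ \Po _).
rewrite comp_polyD comp_polyZ comp_polyX comp_polyC scalerA divff // scale1r.
by rewrite subrK.
Qed.

Lemma conjugate_sym f g : conjugate f g -> conjugate g f.
Proof.
case=> a [b [a0 ->]]; apply/conjugateP; exists a^-1, (- (a^-1 * b)).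
split; first by rewrite invr_eq0.
have -> : a^-1 *: 'X + (- (a^-1 * b))%:P = a^-1 *: ('X - b%:P).
  by rewrite scalerBr polyCN polyCM mul_polyC.
rewrite comp_polyA (_ : _ \Po (a *: _ + _) = 'X) ?comp_polyX //.
rewrite comp_polyZ comp_polyB comp_polyX comp_polyC addrK scalerA mulVf //.
by rewrite scale1r.
Qed.

Lemma conjugate_trans f g h : conjugate f g -> conjugate g h -> conjugate f h.
Proof.
move=> /conjugateP [a [b [a0 e]]] /conjugateP [c [d [c0 e']]].
apply/conjugateP; exists (c * a), (c * b + d); split; first exact: mulf_neq0.
have -> : (c * a) *: 'X + (c * b + d)%:P = (c *: 'X + d%:P) \Po (a *: 'X + b%:P).
  rewrite comp_polyD comp_polyZ comp_polyX comp_polyC scalerDr scalerA.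
  by rewrite polyCD polyCM mul_polyC addrA.
by rewrite comp_polyA e' -!comp_polyA e.
Qed.

(** The affine map [y |-> a * y + b] carries orbits to orbits and, by the chain rule, critical
    points to critical points. *)
Lemma conjugate_PCF f g : conjugate f g -> PCF f -> PCF g.
Proof.
case=> a [b [a0 ->]] pcf x; set h := _ \Po _.
have hE y : h.[y] = a * f.[a^-1 * (y - b)] + b.
  by rewrite /h !(horner_comp, hornerE).
have iterE n : iter n (horner h) x = a * iter n (horner f) (a^-1 * (x - b)) + b.
  elim: n => [|n IHn] /=; first by rewrite mulrA divff // mul1r subrK.
  by rewrite IHn hE addrK mulKf.
move=> hx; have [|s fs] := pcf (a^-1 * (x - b)).
  move: hx; rewrite /critical_point /root /h !deriv_comp.
  rewrite !(derivD, derivN, derivZ, derivX, derivC) oppr0 !addr0.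
  by rewrite !(horner_comp, hornerE) /= !mulf_eq0 invr_eq0 (negPf a0) oner_eq0 !orbF.
exists [seq a * y + b | y <- s] => n; rewrite iterE; exact: map_f.
Qed.

(** Conjugation by [z |-> - z] changes the sign of [g] and keeps [m]. *)
Lemma conjugate_normal_cubic_sqr m g g' : g ^+ 2 = g' ^+ 2 ->
  conjugate (normal_cubic m g) (normal_cubic m g').
Proof.
move=> /eqP; rewrite eqf_sqr => /orP gg'; apply/conjugate_cubicE.
case: gg' => /eqP->.
  by exists 1, 0; rewrite oner_eq0; split=> //; congr cubic; field.
by exists (-1), 0; rewrite oppr_eq0 oner_eq0; split=> //; congr cubic; field.
Qed.

(** * The fifteen polynomials, as coefficient tuples on which [vm_compute] evaluates invariants and
    orbits *)

Definition cubicPCF_coefs : seq (rat * rat * rat * rat) :=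
  [:: (1, 0, 0, 0);
      (-1, 0, 0, 1);
      (-2, 3, 0, 1 / 2);
      (-2, 3, 0, 0);
      (-1, 3 / 2, 0, 1);
      (2, -3, 0, 1);
      (2, -3, 0, 1 / 2);
      (1, - (3 / 2), 0, 0);
      (-3, 9 / 2, 0, 0);
      (-4, 6, 0, - (1 / 2));
      (4, -6, 0, 3 / 2);
      (3, - (9 / 2), 0, 1);
      (-1, 3 / 2, 0, -1);
      (- (1 / 4), 0, 3 / 2, 2);
      (- (1 / 28), 0, - (3 / 4), 7 / 2)].

Definition cubic_of (t : rat * rat * rat * rat) : {poly rat} :=
  cubic t.1.1.1 t.1.1.2 t.1.2 t.2.

Lemma cubicPCFlistE : cubicPCFlist = map cubic_of cubicPCF_coefs.
Proof.
rewrite /cubicPCFlist /cubicPCF_coefs /= /cubic_of /cubic /=.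
by congr [:: _; _; _; _; _; _; _; _; _; _; _; _; _; _; _];
  rewrite ?(scale1r, scaleN1r, scale0r, addr0, polyC1, polyC0, scaleNr, polyCN).
Qed.

Lemma toQbar_cubic (A B C D : rat) :
  toQbar (cubic A B C D) = cubic (ratr A) (ratr B) (ratr C) (ratr D).
Proof.
by rewrite /toQbar /cubic !rmorphD /= !map_polyZ /= !map_polyXn map_polyX map_polyC.
Qed.

Lemma fmorph_crit_invariant (F F' : fieldType) (f : {rmorphism F -> F'}) (A B C D : F) :
  crit_invariant (f A) (f B) (f C) (f D) = f (crit_invariant A B C D).
Proof.
by rewrite /crit_invariant !(rmorph_nat, rmorphXn, fmorphV, rmorphM, rmorphB).
Qed.

Lemma fmorph_const_invariant (F F' : fieldType) (f : {rmorphism F -> F'}) (A B C D : F) :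
  const_invariant (f A) (f B) (f C) (f D) = f (const_invariant A B C D).
Proof.
rewrite /const_invariant /centred_coef.
by rewrite !(rmorph_nat, rmorphXn, fmorphV, rmorphM, rmorphB, rmorphD).
Qed.

Lemma cubicPCF_coefs_inv :
  [seq (crit_invariant t.1.1.1 t.1.1.2 t.1.2 t.2,
        const_invariant t.1.1.1 t.1.1.2 t.1.2 t.2)
     | t <- cubicPCF_coefs] =
  [seq ((int_of_Z mk.1)%:Q, (int_of_Z mk.2)%:Q) | mk <- PCF_invariants].
Proof. by apply/eqP; vm_compute. Qed.

Definition quadratic_disc (F : fieldType) (A B C : F) : F :=
  (B ^+ 2 - 3 * A * C) / (9 * A ^+ 2).

(* For a critical point x, the number b = x + B/(3A) satisfies
   b^2 = quadratic_disc A B C, and the pair (u, v) stands for u + v b. *)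
Definition quadratic_step (F : fieldType) (A B C D : F) (p : F * F) : F * F :=
  let d := quadratic_disc A B C in
  (A * (p.1 ^+ 3 + 3 * p.1 * p.2 ^+ 2 * d) + B * (p.1 ^+ 2 + p.2 ^+ 2 * d)
   + C * p.1 + D,
   A * (3 * p.1 ^+ 2 * p.2 + p.2 ^+ 3 * d) + B * (2 * p.1 * p.2) + C * p.2).

Lemma fmorph_quadratic_disc (F F' : fieldType) (f : {rmorphism F -> F'}) (A B C : F) :
  f (quadratic_disc A B C) = quadratic_disc (f A) (f B) (f C).
Proof.
by rewrite /quadratic_disc !(rmorph_nat, rmorphXn, fmorphV, rmorphM, rmorphB).
Qed.

Lemma fmorph_quadratic_step (F F' : fieldType) (f : {rmorphism F -> F'})
    (A B C D u v : F) :
  quadratic_step (f A) (f B) (f C) (f D) (f u, f v) =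
  (f (quadratic_step A B C D (u, v)).1, f (quadratic_step A B C D (u, v)).2).
Proof.
rewrite /quadratic_step -fmorph_quadratic_disc /=.
by rewrite !(rmorph_nat, rmorphXn, rmorphM, rmorphD).
Qed.

(** Every critical point is [- B / (3 * A) + b] with [b^2] equal to [quadratic_disc A B C], so the
    single orbit of rational pairs from [(- B / (3 * A), 1)] covers them all. *)
Lemma looping_PCF (A B C D : rat) n : A != 0 ->
    looping (quadratic_step A B C D) (- B / (3 * A), 1) n ->
  PCF (toQbar (cubic A B C D)).
Proof.
move=> A0 /loopingP loop x; rewrite toQbar_cubic.
have A0' : ratr A != 0 :> algC by rewrite fmorph_eq0.
set f := cubic _ _ _ _.
rewrite /critical_point /root /f /cubic !(derivD, derivZ, derivC, derivXn, derivX).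
rewrite !hornerE /= => /eqP fx.
pose b := x + ratr (B / (3 * A)).
have bE : b = x + ratr B / (3 * ratr A).
  by rewrite /b fmorph_div rmorphM rmorph_nat.
have b2 : b ^+ 2 = quadratic_disc (ratr A) (ratr B) (ratr C).
  rewrite /quadratic_disc bE; apply/eqP; rewrite -subr_eq0; apply/eqP.
  (* The difference is [f'(x) / (3 * A)], which vanishes at a critical point. *)
  transitivity ((3 * ratr A * x ^+ 2 + 2 * ratr B * x + ratr C) / (3 * ratr A)).
    by field; rewrite A0'.
  by rewrite (_ : _ + ratr C = 0) ?mul0r // -[RHS]fx; ring.
pose ev (p : rat * rat) := ratr p.1 + ratr p.2 * b.
have evE p : f.[ev p] = ev (quadratic_step A B C D p).
  case: p => u v; rewrite /ev.
  have [<- <-] := fmorph_quadratic_step (@ratr algC) A B C D u v.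
  rewrite -b2 /f horner_cubic /=; ring.
have iterE m : iter m (horner f) x =
    ev (iter m (quadratic_step A B C D) (- B / (3 * A), 1)).
  elim: m => [|m IHm] /=; last by rewrite IHm evE.
  by rewrite /ev /= rmorph1 mul1r /b mulNr rmorphN; ring.
exists (map ev (traject (quadratic_step A B C D) (- B / (3 * A), 1) n)) => m.
by rewrite iterE map_f.
Qed.

(** Eight steps suffice for each of the fifteen orbits of pairs to repeat. *)
Lemma cubicPCF_coefs_looping : all (fun t =>
  (t.1.1.1 != 0) && looping (quadratic_step t.1.1.1 t.1.1.2 t.1.2 t.2)
     (- t.1.1.2 / (3 * t.1.1.1), 1) 8) cubicPCF_coefs.
Proof. by vm_compute. Qed.

Lemma ratr_crit_invariant (A B C D : rat) :
  crit_invariant (ratr A) (ratr B) (ratr C) (ratr D) =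
  ratr (crit_invariant A B C D) :> algC.
Proof. exact: fmorph_crit_invariant. Qed.

Lemma ratr_const_invariant (A B C D : rat) :
  const_invariant (ratr A) (ratr B) (ratr C) (ratr D) =
  ratr (const_invariant A B C D) :> algC.
Proof. exact: fmorph_const_invariant. Qed.

Lemma eq_map_nth (T T' R : Type) (x : T) (x' : T') (h : T -> R) (h' : T' -> R)
    (s : seq T) (s' : seq T') i :
  map h s = map h' s' -> (i < size s)%N -> (i < size s')%N ->
  h (nth x s i) = h' (nth x' s' i).
Proof.
by move=> e si si'; rewrite -(nth_map x (h (nth x s i))) // e (nth_map x').
Qed.

Lemma cubicPCF_coefs_nth i : (i < 15)%N ->
  let t := nth (0, 0, 0, 0) cubicPCF_coefs i in
  let mk := nth (0%BinZ, 0%BinZ) PCF_invariants i in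
  [/\ t.1.1.1 != 0, cubicPCFlist`_i = cubic_of t,
      crit_invariant (ratr t.1.1.1) (ratr t.1.1.2) (ratr t.1.2) (ratr t.2) = ZtoC mk.1 &
      const_invariant (ratr t.1.1.1) (ratr t.1.1.2) (ratr t.1.2) (ratr t.2) = ZtoC mk.2].
Proof.
move=> i15 t mk; have tE : t \in cubicPCF_coefs by rewrite mem_nth.
have size1 : (i < size cubicPCF_coefs)%N by [].
have size2 : (i < size PCF_invariants)%N by [].
have := eq_map_nth (0, 0, 0, 0) (0%BinZ, 0%BinZ) cubicPCF_coefs_inv size1 size2.
rewrite -/t -/mk.
have /andP[A0 _] := allP cubicPCF_coefs_looping t tE.
case=> e1 e2; rewrite ratr_crit_invariant ratr_const_invariant e1 e2 !ratr_int.
rewrite cubicPCFlistE.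
split=> //; exact: (nth_map (0, 0, 0, 0) _ _ size1).
Qed.

Theorem mainTheorem1 :
  [/\ size cubicPCFlist = 15%N,
      (forall f : {poly rat}, f \in cubicPCFlist ->
         size f = 4%N /\ PCF (toQbar f)),
      (forall i j : nat, (i < 15)%N -> (j < 15)%N -> i <> j ->
         ~ conjugate (toQbar cubicPCFlist`_i) (toQbar cubicPCFlist`_j))
    & (forall f : {poly rat}, size f = 4%N -> PCF (toQbar f) ->
         exists2 g : {poly rat}, g \in cubicPCFlist &
           conjugate (toQbar f) (toQbar g))].
Proof.
split=> //.
- move=> f; rewrite cubicPCFlistE => /mapP[t /(allP cubicPCF_coefs_looping)].
  by case/andP=> A0 loop ->; split; [apply: size_cubic | apply: looping_PCF loop].
- move=> i j i15 j15 ij.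
  have [A0 -> m_i k_i] := cubicPCF_coefs_nth i15.
  have [_ -> m_j k_j] := cubicPCF_coefs_nth j15.
  rewrite !toQbar_cubic => /conjugate_invariants[]; first by rewrite fmorph_eq0.
  rewrite m_i m_j k_i k_j => /ZtoC_inj e1 /ZtoC_inj e2.
  (* The invariant pairs are pairwise distinct, so equal invariants force equal indices. *)
  apply: ij; apply/eqP; rewrite -(@nth_uniq _ (0%BinZ, 0%BinZ) PCF_invariants) //.
  by rewrite [X in X == _]surjective_pairing e1 e2 -surjective_pairing.
- move=> f f4 pcf; have fE := cubicE (eq_leq f4).
  have A0 : f`_3 != 0 by have := lead_coef_eq0 f; rewrite lead_coefE f4 => ->;
    rewrite -size_poly_eq0 f4.
  move: (f`_3) (f`_2) (f`_1) (f`_0) A0 fE pcf => A B C D A0 -> pcf.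
  rewrite toQbar_cubic in pcf *.
  have A0' : ratr A != 0 :> algC by rewrite fmorph_eq0.
  (* Here [g] may be irrational; only [m] and [g ^+ 2] are known to be rational. *)
  have [g g2 conj_g] := conjugate_normal_cubic (ratr B) (ratr C) (ratr D) A0'.
  have inv1Q := Crat_rat (crit_invariant A B C D).
  have inv2Q := Crat_rat (const_invariant A B C D).
  rewrite -ratr_crit_invariant in inv1Q; rewrite -ratr_const_invariant -g2 in inv2Q.
  have [mk mk_in [m_k k_k]] :=
    PCF_normal_cubic_invariants inv1Q inv2Q (conjugate_PCF conj_g pcf).
  have [i i15 mkE] := nthP (0%BinZ, 0%BinZ) mk_in.
  exists cubicPCFlist`_i; first exact: mem_nth.
  have := cubicPCF_coefs_nth i15.
  move: (nth _ cubicPCF_coefs i) => t [A1 -> m_i k_i].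
  rewrite toQbar_cubic; apply: (conjugate_trans conj_g); apply: conjugate_sym.
  move: A1; rewrite -(fmorph_eq0 (@ratr algC)) => A1.
  (* The listed cubic has a normal form with the same [m] and with [g'] equal to [g] up to sign,
     which links it to [f]. *)
  have [g' g2' conj_g'] :=
    conjugate_normal_cubic (ratr t.1.1.2) (ratr t.1.2) (ratr t.2) A1.
  apply: (conjugate_trans conj_g'); rewrite m_i m_k -mkE.
  by apply: conjugate_normal_cubic_sqr; rewrite g2' k_k k_i mkE.
Qed.
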